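(* Let $G$ be a finitely generated group and $\phi\in\mathrm{End}(G)$. Let $\widehat G$ be the profinite completion of $G$, $\widehat\phi$ the continuous extension of $\phi$ to $\widehat G$, and $j_\phi\colon\mathcal R(\phi)\to\mathcal R(\widehat\phi)$ the map induced by the canonical homomorphism $G\to\widehat G$, with induced homomorphism $(j_\phi)_\#\colon\mathbb Z[\mathcal R(\phi)]\to\mathbb Z[\mathcal R(\widehat\phi)]$. Then the blind subgroup $\mathcal B_\phi$ satisfies $$\mathcal B_\phi=\ker(j_\phi)_\#=\left\langle[\alpha]-[\beta]:\alpha,\beta\in\mathcal R(\phi),\ j_\phi(\alpha)=j_\phi(\beta)\right\rangle.$$ Consequently, $\mathbb Z[\mathcal R(\phi)]/\mathcal B_\phi\cong\mathbb Z[\mathrm{im}\,j_\phi]$.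
   Context: For an endomorphism $\phi$ of a group $G$, write $a\sim_\phi b$ if $b=ga\phi(g)^{-1}$ for some $g\in G$; $\mathcal R(\phi)$ is the set of classes (same definition for $\widehat\phi$ on $\widehat G$), and $\mathbb Z[S]$ is the free abelian group on a set $S$. A finite observer for $(G,\phi)$ is a finite-index normal subgroup $N\triangleleft G$ with $\phi(N)\subseteq N$; $q_N\colon G\to G/N$ is the quotient map, $\bar\phi_N$ the induced endomorphism of $G/N$, $(q_N)_R\colon\mathcal R(\phi)\to\mathcal R(\bar\phi_N)$, $[a]\mapsto[q_N(a)]$, and $((q_N)_R)_\#$ is the induced map of free abelian groups. The finite-observer blind subgroup is $$\mathcal B_\phi=\bigcap_N\ker\left(((q_N)_R)_\#\colon\mathbb Z[\mathcal R(\phi)]\to\mathbb Z[\mathcal R(\bar\phi_N)]\right),$$ the intersection being over all finite observers $N$; it is a subgroup of $\mathbb Z[\mathcal R(\phi)]$. *)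

(* Defs.v *)
From HB Require Import structures.
From mathcomp Require Import all_boot all_order all_algebra.
From mathcomp Require Import all_classical topology.
From mathcomp Require Import freeg.

Set Implicit Arguments.
Unset Strict Implicit.
Unset Printing Implicit Defensive.

Import GRing.Theory.

Local Open Scope classical_set_scope.
Local Open Scope quotient_scope.
Local Open Scope group_scope.

Notation "{ 'ghom' G -> H }" := (UMagmaMorphism.type G H)
  (at level 0, G at level 98, H at level 99,
   format "{ 'ghom'  G  ->  H }") : type_scope.

Definition finitely_generated (G : groupType) : Prop :=
  exists s : seq G,
    smallest [set H : set G | group_closed [in H]] [set` s] = [set: G].

Section NormalSubgroup.
Variable G : groupType.

Record normal_subgroup := NormalSubgroup {
  nsub_set : set G;
  nsub_group : group_closed [in nsub_set];
  nsub_normal : forall x g, nsub_set x -> nsub_set (x ^ g)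
}.

Variable N : normal_subgroup.

Lemma nsub1 : nsub_set N 1.
Proof. by have [/set_mem] := nsub_group N. Qed.

Lemma nsubF x y : nsub_set N x -> nsub_set N y -> nsub_set N (x / y).
Proof.
by move=> Nx Ny; have [_ h] := nsub_group N; apply/set_mem/h; apply/mem_set.
Qed.

Lemma nsubV x : nsub_set N x -> nsub_set N x^-1.
Proof. by move=> Nx; rewrite -[_^-1]mul1g; apply: nsubF => //; apply: nsub1. Qed.

Lemma nsubM x y : nsub_set N x -> nsub_set N y -> nsub_set N (x * y).
Proof. by move=> Nx Ny; rewrite -[y]invgK; apply: nsubF => //; apply: nsubV. Qed.

Definition coset_rel : rel G := fun x y => x^-1 * y \in nsub_set N.

Lemma coset_relP x y : reflect (nsub_set N (x^-1 * y)) (coset_rel x y).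
Proof. by apply: (iffP idP) => [/set_mem|/mem_set]. Qed.

Lemma coset_rel_equiv : equiv_class_of coset_rel.
Proof.
split=> [x|x y|y x z].
- by apply/coset_relP; rewrite mulVg; apply: nsub1.
- by apply/coset_relP/coset_relP => /nsubV; rewrite invgM invgK.
- move=> /coset_relP xy /coset_relP yz; apply/coset_relP.
  by have := nsubM xy yz; rewrite mulgA mulgK.
Qed.

Canonical coset_equiv := EquivRelPack coset_rel_equiv.
Canonical coset_encModRel := defaultEncModRel coset_rel.

Definition quotg := {eq_quot coset_rel}.

HB.instance Definition _ : EqQuotient G coset_rel quotg := EqQuotient.on quotg.
HB.instance Definition _ := Choice.on quotg.

Definition quotg_pi (x : G) : quotg := \pi_quotg x.

Lemma quotg_surj a : exists x, a = quotg_pi x.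
Proof. by exists (repr a); rewrite /quotg_pi reprK. Qed.

Lemma quotg_eqP x y : quotg_pi x = quotg_pi y <-> nsub_set N (x^-1 * y).
Proof.
split=> [/eqmodP|h]; first by move/coset_relP.
by apply/eqmodP/coset_relP.
Qed.

Lemma coset_repr x : nsub_set N (x^-1 * repr (quotg_pi x)).
Proof. by apply/quotg_eqP; rewrite /quotg_pi reprK. Qed.

Definition quotg_mul (a b : quotg) : quotg := quotg_pi (repr a * repr b).
Definition quotg_inv (a : quotg) : quotg := quotg_pi (repr a)^-1.

Lemma quotg_mulE x y : quotg_mul (quotg_pi x) (quotg_pi y) = quotg_pi (x * y).
Proof.
apply/esym/quotg_eqP; set x' := repr _; set y' := repr _.
have -> : (x * y)^-1 * (x' * y') = (x^-1 * x') ^ y * (y^-1 * y').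
  by rewrite /conjg invgM !mulgA mulgK.
by apply: nsubM; [apply: nsub_normal|]; apply: coset_repr.
Qed.

Lemma quotg_invE x : quotg_inv (quotg_pi x) = quotg_pi x^-1.
Proof.
apply/quotg_eqP; rewrite invgK; set x' := repr _.
have -> : x' * x^-1 = (x^-1 * x') ^ (x^-1).
  by rewrite /conjg invgK !mulgA mulgV mul1g.
by apply: nsub_normal; apply: coset_repr.
Qed.

Lemma quotg_mulA : associative quotg_mul.
Proof.
move=> a b c; have [x ->] := quotg_surj a; have [y ->] := quotg_surj b; have [z ->] := quotg_surj c.
by rewrite !quotg_mulE mulgA.
Qed.

Lemma quotg_mul1 : left_id (quotg_pi 1) quotg_mul.
Proof. by move=> a; have [x ->] := quotg_surj a; rewrite quotg_mulE mul1g. Qed.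

Lemma quotg_mul1r : right_id (quotg_pi 1) quotg_mul.
Proof. by move=> a; have [x ->] := quotg_surj a; rewrite quotg_mulE mulg1. Qed.

Lemma quotg_mulV : left_inverse (quotg_pi 1) quotg_inv quotg_mul.
Proof. by move=> a; have [x ->] := quotg_surj a; rewrite quotg_invE quotg_mulE mulVg. Qed.

Lemma quotg_mulVr : right_inverse (quotg_pi 1) quotg_inv quotg_mul.
Proof. by move=> a; have [x ->] := quotg_surj a; rewrite quotg_invE quotg_mulE mulgV. Qed.

HB.instance Definition _ := isGroup.Build quotg
  quotg_mulA quotg_mul1 quotg_mul1r quotg_mulV quotg_mulVr.

Lemma quotg_pi_monoid_morphism : monoid.monoid_morphism quotg_pi.
Proof. by split=> // x y; rewrite -quotg_mulE. Qed.

HB.instance Definition _ :=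
  isUMagmaMorphism.Build G quotg quotg_pi quotg_pi_monoid_morphism.

Definition finite_index : Prop := finite_set [set: quotg].

End NormalSubgroup.

Section QuotientMap.
Variables (G H : groupType) (f : {ghom G -> H}).
Variables (M : normal_subgroup G) (N : normal_subgroup H).

(* The proof fMN is not used to compute, but it makes the value independent of
   the representative (quotg_mapE); likewise for reidemeister_map. *)
Definition quotg_map (fMN : forall x, nsub_set M x -> nsub_set N (f x))
    (c : quotg M) : quotg N := quotg_pi N (f (repr c)).

Hypothesis fMN : forall x, nsub_set M x -> nsub_set N (f x).

Lemma quotg_mapE x : quotg_map fMN (quotg_pi M x) = quotg_pi N (f x).
Proof.
apply/esym/quotg_eqP; rewrite -gmulfV -gmulfM; apply: fMN.
exact: coset_repr.
Qed.

Lemma quotg_map_monoid_morphism : monoid.monoid_morphism (quotg_map fMN).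
Proof.
split; first by rewrite -[1]/(quotg_pi M 1) quotg_mapE !gmulf1.
move=> a b; have [x ->] := quotg_surj a; have [y ->] := quotg_surj b.
by rewrite -gmulfM !quotg_mapE !gmulfM.
Qed.

HB.instance Definition _ := isUMagmaMorphism.Build
  (quotg M) (quotg N) (quotg_map fMN) quotg_map_monoid_morphism.

End QuotientMap.
Arguments quotg_map {G H} f {M N} fMN.

Section Reidemeister.
Variables (G : groupType) (phi : {ghom G -> G}).

Definition twisted_conj : rel G :=
  fun a b => `[< exists g, b = g * a * (phi g)^-1 >].

Lemma twisted_conj_equiv : equiv_class_of twisted_conj.
Proof.
have sym a b : twisted_conj a b -> twisted_conj b a.
  move=> /asboolP[g ->]; apply/asboolP; exists g^-1.
  by rewrite gmulfV invgK !mulgA mulVg mul1g mulgVK.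
split=> [a|a b|b a c].
- by apply/asboolP; exists 1; rewrite gmulf1 invg1 mul1g mulg1.
- by apply/idP/idP; apply: sym.
- move=> /asboolP[g ->] /asboolP[h ->]; apply/asboolP; exists (h * g).
  by rewrite gmulfM invgM !mulgA.
Qed.

Canonical twisted_equiv := EquivRelPack twisted_conj_equiv.
Canonical twisted_encModRel := defaultEncModRel twisted_conj.

Definition reidemeister := {eq_quot twisted_conj}.

HB.instance Definition _ : EqQuotient G twisted_conj reidemeister :=
  EqQuotient.on reidemeister.
HB.instance Definition _ := Choice.on reidemeister.

Definition rclass (a : G) : reidemeister := \pi_reidemeister a.

Lemma rclass_eqP a b :
  rclass a = rclass b <-> exists g, b = g * a * (phi g)^-1.
Proof.
split=> [/eqmodP/asboolP //|h].
by apply/eqmodP/asboolP.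
Qed.

End Reidemeister.

Section ReidemeisterMap.
Variables (G H : groupType) (f : {ghom G -> H}).
Variables (phi : {ghom G -> G}) (psi : {ghom H -> H}).

Definition reidemeister_map (fI : forall x, f (phi x) = psi (f x))
    (c : reidemeister phi) : reidemeister psi :=
  rclass psi (f (repr c)).

Hypothesis fI : forall x, f (phi x) = psi (f x).

Lemma reidemeister_mapE a :
  reidemeister_map fI (rclass phi a) = rclass psi (f a).
Proof.
rewrite /reidemeister_map; set b := repr _.
have /rclass_eqP[g ->] : rclass phi b = rclass phi a by exact: reprK.
by apply/rclass_eqP; exists (f g); rewrite !gmulfM gmulfV fI.
Qed.

End ReidemeisterMap.
Arguments reidemeister_map {G H} f {phi psi} fI.

Section FreeAbelian.
Local Open Scope ring_scope.
Variables (S T : choiceType) (f : S -> T).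

Definition freeg_map : {freeg S / int} -> {freeg T / int} :=
  fglift (fun s => << f s >> : {freeg T / int}).

Lemma freeg_map_zmod_morphism : zmod_morphism freeg_map.
Proof. exact: lift_is_additive. Qed.

HB.instance Definition _ := GRing.isZmodMorphism.Build
  {freeg S / int} {freeg T / int} freeg_map freeg_map_zmod_morphism.

Lemma freeg_mapU s : freeg_map << s >> = << f s >>.
Proof. by rewrite /freeg_map liftU scale1r. Qed.

End FreeAbelian.

Section Kernel.
Local Open Scope ring_scope.
Variables (U V : zmodType).

Definition ker (f : {additive U -> V}) : set U := [set u | f u = 0].

Definition generated_subgroup (A : set U) : set U :=
  smallest [set H : set U | zmod_closed [in H]] A.

End Kernel.

Section Blind.
Variables (G : groupType) (phi : {ghom G -> G}).

Record observer := Observer {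
  obs_nsub :> normal_subgroup G;
  obs_finite : finite_index obs_nsub;
  obs_stable : forall x, nsub_set obs_nsub x -> nsub_set obs_nsub (phi x)
}.

Definition obs_endo (N : observer) : {ghom quotg N -> quotg N} :=
  quotg_map phi (@obs_stable N).

Lemma obs_endoE (N : observer) x :
  quotg_pi N (phi x) = obs_endo N (quotg_pi N x).
Proof. by rewrite /obs_endo /= quotg_mapE. Qed.

Definition obs_reidemeister (N : observer) :
    reidemeister phi -> reidemeister (obs_endo N) :=
  reidemeister_map (quotg_pi N) (obs_endoE N).

Definition blind : set {freeg (reidemeister phi) / int} :=
  \bigcap_N ker (freeg_map (obs_reidemeister N)).

(* Boolean form of blind, with the ZmodClosed instance that Quotient.quot needs. *)
Definition blind_pred : {pred {freeg (reidemeister phi) / int}} := [in blind].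

Lemma blind_zmod_closed : zmod_closed blind_pred.
Proof.
split; first by apply/mem_set => N _; rewrite /ker /= raddf0.
move=> u v /set_mem Bu /set_mem Bv; apply/mem_set => N _.
by rewrite /ker /= raddfB /= (Bu N I) (Bv N I) subr0.
Qed.

HB.instance Definition _ := GRing.isZmodClosed.Build
  {freeg (reidemeister phi) / int} blind_pred blind_zmod_closed.

End Blind.
Arguments blind {G} phi _.
Arguments blind_pred {G} phi _.

Section ProfiniteCompletion.
Variable G : groupType.

Record fin_nsub := FinNsub {
  fin_nsub_val :> normal_subgroup G;
  fin_nsubP : finite_index fin_nsub_val
}.

HB.instance Definition _ := gen_eqMixin fin_nsub.

Definition quotg_transition (M N : fin_nsub) (MN : nsub_set M `<=` nsub_set N) :
    {ghom quotg M -> quotg N} :=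
  quotg_map idfun MN.

Definition finite_quotients : topologicalType :=
  prod_topology (fun N : fin_nsub => discrete_topology (quotg N)).

Definition coherent : set finite_quotients :=
  [set x | forall (M N : fin_nsub) (MN : nsub_set M `<=` nsub_set N),
     quotg_transition MN (x M) = x N].

(* The inverse limit of the finite quotients, with the subspace topology of
   the product of discrete spaces. *)
Definition profinite : Type := set_type coherent.

HB.instance Definition _ := Topological.on profinite.

Definition profinite_proj (N : fin_nsub) (x : profinite) : quotg N := val x N.

Lemma quotg_transitionE (M N : fin_nsub) (MN : nsub_set M `<=` nsub_set N) g :
  quotg_transition MN (quotg_pi M g) = quotg_pi N g.
Proof. exact: quotg_mapE. Qed.

Lemma profinite_coherent (x : profinite) (M N : fin_nsub)
    (MN : nsub_set M `<=` nsub_set N) :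
  quotg_transition MN (profinite_proj M x) = profinite_proj N x.
Proof. exact: (set_mem (valP x)). Qed.

Lemma profinite_ext (x y : profinite) :
  (forall N, profinite_proj N x = profinite_proj N y) -> x = y.
Proof.
by move=> xy; apply/val_inj/functional_extensionality_dep => N; apply: xy.
Qed.

Definition profinite_of (x : forall N : fin_nsub, quotg N)
    (hx : forall (M N : fin_nsub) (MN : nsub_set M `<=` nsub_set N),
       quotg_transition MN (x M) = x N) : profinite :=
  exist _ (x : finite_quotients) (mem_set hx).

Definition profinite_mul (x y : profinite) : profinite.
Proof.
apply: (@profinite_of (fun N => profinite_proj N x * profinite_proj N y)).
by move=> M N MN; rewrite gmulfM !profinite_coherent.
Defined.

Definition profinite_one : profinite.
Proof. by apply: (@profinite_of (fun N => 1)) => M N MN; rewrite gmulf1. Defined.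

Definition profinite_inv (x : profinite) : profinite.
Proof.
apply: (@profinite_of (fun N => (profinite_proj N x)^-1)).
by move=> M N MN; rewrite gmulfV profinite_coherent.
Defined.

Lemma profinite_mulA : associative profinite_mul.
Proof. by move=> x y z; apply: profinite_ext => N; apply: mulgA. Qed.

Lemma profinite_mul1 : left_id profinite_one profinite_mul.
Proof. by move=> x; apply: profinite_ext => N; apply: mul1g. Qed.

Lemma profinite_mul1r : right_id profinite_one profinite_mul.
Proof. by move=> x; apply: profinite_ext => N; apply: mulg1. Qed.

Lemma profinite_mulV : left_inverse profinite_one profinite_inv profinite_mul.
Proof. by move=> x; apply: profinite_ext => N; apply: mulVg. Qed.

Lemma profinite_mulVr : right_inverse profinite_one profinite_inv profinite_mul.
Proof. by move=> x; apply: profinite_ext => N; apply: mulgV. Qed.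

HB.instance Definition _ := isGroup.Build profinite
  profinite_mulA profinite_mul1 profinite_mul1r profinite_mulV profinite_mulVr.

Definition to_profinite (g : G) : profinite.
Proof.
apply: (@profinite_of (fun N => quotg_pi N g)).
by move=> M N MN; apply: quotg_transitionE.
Defined.

Lemma to_profinite_monoid_morphism : monoid.monoid_morphism to_profinite.
Proof.
by split=> [|x y]; apply: profinite_ext => N; [apply: gmulf1|apply: gmulfM].
Qed.

HB.instance Definition _ :=
  isUMagmaMorphism.Build G profinite to_profinite to_profinite_monoid_morphism.

End ProfiniteCompletion.

Section ContinuousExtension.
Variables (G : groupType) (phi : {ghom G -> G}).

(* Such a psi exists (profinite_mapP) and is unique
   (continuous_extension_unique). *)
Definition continuous_extension (psi : {ghom profinite G -> profinite G}) :=
  continuous psi /\ forall g, to_profinite (phi g) = psi (to_profinite g).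

Definition preim_nsub (N : normal_subgroup G) : normal_subgroup G.
Proof.
apply: (@NormalSubgroup G (phi @^-1` nsub_set N)).
- split; first by apply/mem_set; rewrite /preimage /= gmulf1; apply: nsub1.
  move=> x y /set_mem Nx /set_mem Ny; apply/mem_set.
  by rewrite /preimage /= gmulfF; apply: nsubF.
- by move=> x g Nx; rewrite /preimage /= gmulfJ; apply: nsub_normal.
Defined.

Definition preim_map (N : normal_subgroup G) :
    {ghom quotg (preim_nsub N) -> quotg N} :=
  quotg_map phi (fun x (h : nsub_set (preim_nsub N) x) => h).

Lemma preim_mapE N x :
  preim_map N (quotg_pi (preim_nsub N) x) = quotg_pi N (phi x).
Proof. exact: quotg_mapE. Qed.

Lemma preim_map_inj N : injective (preim_map N).
Proof.
move=> a b; have [x ->] := quotg_surj a; have [y ->] := quotg_surj b.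
rewrite !preim_mapE => /quotg_eqP h; apply/quotg_eqP.
by rewrite /= /preimage /= gmulfM gmulfV.
Qed.

Lemma preim_finite (N : fin_nsub G) : finite_index (preim_nsub N).
Proof.
rewrite /finite_index -(preimage_setT (preim_map N)).
apply: finite_preimage; last exact: fin_nsubP.
by move=> x y _ _; apply: preim_map_inj.
Qed.

Definition preim_fin (N : fin_nsub G) : fin_nsub G := FinNsub (preim_finite N).

Definition profinite_map (x : profinite G) : profinite G.
Proof.
apply: (@profinite_of G (fun N => preim_map N (profinite_proj (preim_fin N) x))).
move=> M N MN.
have MN' : nsub_set (preim_fin M) `<=` nsub_set (preim_fin N).
  by move=> y; apply: MN.
rewrite -(profinite_coherent x MN').
have [y ->] := quotg_surj (profinite_proj (preim_fin M) x).
by rewrite quotg_transitionE !preim_mapE quotg_transitionE.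
Defined.

Lemma profinite_map_monoid_morphism : monoid.monoid_morphism profinite_map.
Proof.
split=> [|x y]; apply: profinite_ext => N.
  exact: (gmulf1 (s := preim_map N)).
exact: (gmulfM (s := preim_map N)).
Qed.

HB.instance Definition _ := isUMagmaMorphism.Build
  (profinite G) (profinite G) profinite_map profinite_map_monoid_morphism.

Lemma profinite_proj_continuous (N : fin_nsub G) :
  continuous (@profinite_proj G N : profinite G -> discrete_topology (quotg N)).
Proof.
pose T (M : fin_nsub G) := discrete_topology (quotg M) : topologicalType.
move=> x; apply: (@continuous_comp (profinite G) (prod_topology T) (T N)
  set_val (@proj _ T N)).
  exact: (@initial_continuous (profinite G) (prod_topology T) set_val).
exact: (@proj_continuous _ T).
Qed.

Lemma profinite_map_continuous : continuous profinite_map.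
Proof.
pose T (M : fin_nsub G) := discrete_topology (quotg M) : topologicalType.
apply: continuous_comp_initial => x.
apply/cvg_sup; first exact/fmap_filter/(nbhs_filter x).
move=> N; move: x.
apply: (@continuous_comp_initial _ _ (T N) (fun f : prod_topology T => f N)).
move=> x U /nbhs_singleton Ux.
set P := preim_fin N.
have nx : nbhs x [set y | profinite_proj P y = profinite_proj P x].
  exact: (@profinite_proj_continuous P x _
    (@discrete_set1 (discrete_topology (quotg P)) _)).
apply: filterS nx => y /= yx.
have -> : set_val (profinite_map y) N = set_val (profinite_map x) N.
  exact: (congr1 (preim_map N) yx).
exact: Ux.
Qed.

Lemma profinite_mapP : continuous_extension profinite_map.
Proof.
split; first exact: profinite_map_continuous.
by move=> g; apply: profinite_ext => N; apply/esym; apply: preim_mapE.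
Qed.

End ContinuousExtension.

Section Density.
Variable G : groupType.

Definition nsubI (M N : normal_subgroup G) : normal_subgroup G.
Proof.
apply: (@NormalSubgroup G (nsub_set M `&` nsub_set N)).
- split; first by apply/mem_set; split; apply: nsub1.
  by move=> x y /set_mem[Mx Nx] /set_mem[My Ny]; apply/mem_set; split;
    apply: nsubF.
- by move=> x g [Mx Nx]; split; apply: nsub_normal.
Defined.

Lemma nsubI_finite (M N : fin_nsub G) : finite_index (nsubI M N).
Proof.
pose pM := quotg_map idfun (M := nsubI M N) (N := M) (fun x h => proj1 h).
pose pN := quotg_map idfun (M := nsubI M N) (N := N) (fun x h => proj2 h).
pose h c := (pM c, pN c).
rewrite /finite_index -(preimage_setT h) -setXTT.
apply: finite_preimage; last by apply: finite_setX; apply: fin_nsubP.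
move=> a b _ _; have [x ->] := quotg_surj a; have [y ->] := quotg_surj b.
rewrite /h /pM /pN !quotg_mapE => -[/quotg_eqP Mxy /quotg_eqP Nxy].
exact/quotg_eqP.
Qed.

Definition fin_nsubI (M N : fin_nsub G) : fin_nsub G :=
  FinNsub (nsubI_finite M N).

Lemma nsubT_group : group_closed [in [set: G]].
Proof. by split=> [|x y _ _]; apply/mem_set. Qed.

Definition nsubT : normal_subgroup G :=
  NormalSubgroup nsubT_group (fun _ _ _ => I).

Lemma nsubT_finite : finite_index nsubT.
Proof.
apply: (sub_finite_set (B := [set quotg_pi nsubT 1])); last exact: finite_set1.
by move=> c _; have [x ->] := quotg_surj c; apply/quotg_eqP.
Qed.

Lemma profinite_nbhs (x : profinite G) (U : set (profinite G)) : nbhs x U ->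
  exists N, forall y, profinite_proj N y = profinite_proj N x -> U y.
Proof.
pose D (N : fin_nsub G) :=
  [set y : profinite G | profinite_proj N y = profinite_proj N x].
pose F := filter_from [set: fin_nsub G] D.
have FF : Filter F.
  apply: filter_from_filter; first by exists (FinNsub nsubT_finite).
  move=> M N _ _; exists (fin_nsubI M N) => // y /= yx.
  have IM : nsub_set (fin_nsubI M N) `<=` nsub_set M by move=> ? [].
  have IN : nsub_set (fin_nsubI M N) `<=` nsub_set N by move=> ? [].
  split; rewrite /D /=.
    by rewrite -(profinite_coherent y IM) -(profinite_coherent x IM) yx.
  by rewrite -(profinite_coherent y IN) -(profinite_coherent x IN) yx.
pose T (M : fin_nsub G) := discrete_topology (quotg M) : topologicalType.
have cvgF : set_val @ F --> (set_val x : prod_topology T).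
  apply/cvg_sup => N V [_ [[W oW <-] /= Wx]] /filterS; apply.
  exists N => // y yx.
  have E : set_val y N = set_val x N := yx.
  by rewrite /preimage /= E.
case=> _ [[W oW <-] /= Wx] /filterS sWU.
have [N _ DW] : F U by apply: sWU; apply: cvgF; apply: open_nbhs_nbhs.
by exists N.
Qed.

Lemma to_profinite_dense (x : profinite G) (U : set (profinite G)) :
  nbhs x U -> exists g, U (to_profinite g).
Proof.
move=> /profinite_nbhs[N NU]; have [g gx] := quotg_surj (profinite_proj N x).
by exists g; apply: NU; rewrite gx.
Qed.

Lemma continuous_extension_unique (phi : {ghom G -> G})
    (psi1 psi2 : {ghom profinite G -> profinite G}) :
  continuous_extension phi psi1 -> continuous_extension phi psi2 ->
  psi1 =1 psi2.
Proof.
move=> [c1 e1] [c2 e2] x; apply: profinite_ext => N.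
have loc (psi : profinite G -> profinite G) : continuous psi ->
    nbhs x [set y | profinite_proj N (psi y) = profinite_proj N (psi x)].
  move=> c; have nz : nbhs (psi x)
      [set z | profinite_proj N z = profinite_proj N (psi x)].
    exact: (@profinite_proj_continuous G N (psi x) _
      (@discrete_set1 (discrete_topology (quotg N)) _)).
  exact: (c x _ nz).
have [g [<- <-]] := to_profinite_dense (filterI (loc _ c1) (loc _ c2)).
by rewrite -e1 -e2.
Qed.

End Density.

(* Main.v *)
(** Two classes have the same image under [j] exactly when no finite observer
    separates them.  Indeed [G] is finitely generated, so each finite quotient [Q]
    receives finitely many homomorphisms from [G]; the intersection of their kernels
    is a finite observer, so observers are cofinal among the finite-index normal
    subgroups, and a compactness argument glues conjugators modulo each observer
    into a conjugator in the profinite completion.  An element of the free abelian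
    group has finite support and observers are closed under intersection, so a
    single observer separates all the classes of its support that [j] separates;
    hence that observer kills the element only if [j] does. *)
Require Import Defs.
From HB Require Import structures.
From mathcomp Require Import all_boot all_order all_algebra.
From mathcomp Require Import all_classical topology.
From mathcomp Require Import freeg.

Set Implicit Arguments.
Unset Strict Implicit.
Unset Printing Implicit Defensive.

Import GRing.Theory.

Local Open Scope classical_set_scope.
Local Open Scope quotient_scope.
Local Open Scope ring_scope.

(** * Homomorphisms of free abelian groups induced by maps of sets *)

Section FreeAbelianMap.
Variables (S T : choiceType).
Implicit Types (f : S -> T) (u : {freeg S / int}).

Lemma freeg_sum_mulrz u : u = \sum_(a <- dom u) << a >> *~ coeff a u.
Proof.
rewrite -{1}[u]freeg_sumE; apply: eq_bigr => a _.
by rewrite freegU_mulz intz.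
Qed.

Lemma freeg_map_sum f u :
  freeg_map f u = \sum_(a <- dom u) << f a >> *~ coeff a u.
Proof.
rewrite {1}[u]freeg_sum_mulrz raddf_sum; apply: eq_bigr => a _ /=.
by rewrite raddfMz /= freeg_mapU.
Qed.

Lemma eq_in_freeg_map f g u :
  {in dom u, f =1 g} -> freeg_map f u = freeg_map g u.
Proof.
by move=> fg; rewrite !freeg_map_sum; apply: eq_big_seq => a /fg ->.
Qed.

End FreeAbelianMap.

Lemma freeg_map_comp (S T U : choiceType) (f : S -> T) (g : T -> U)
    (u : {freeg S / int}) : freeg_map (g \o f) u = freeg_map g (freeg_map f u).
Proof.
rewrite freeg_map_sum (freeg_map_sum f) raddf_sum; apply: eq_bigr => a _ /=.
by rewrite raddfMz /= freeg_mapU.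
Qed.

Lemma freeg_map_id (S : choiceType) (u : {freeg S / int}) :
  freeg_map id u = u.
Proof. by rewrite freeg_map_sum -freeg_sum_mulrz. Qed.

(** Take for [s t] the first entry of [r] above [t]; since [r] is nonempty, its head can serve as
    the default where [r] has no such entry. *)
Lemma section_on_seq (S T : eqType) (f : S -> T) (r : seq S) :
  r != [::] -> exists s : T -> S,
    {in r, forall a, s (f a) \in r /\ f (s (f a)) = f a}.
Proof.
case: r => // a0 r' _; set r := a0 :: r'.
exists (fun t => nth a0 r (find (fun a => f a == t) r)) => a ra.
have h : has (fun b => f b == f a) r by apply/hasP; exists a.
by split; [rewrite mem_nth -?has_find|apply/eqP/(nth_find a0 h)].
Qed.

(** On the support of [u], [g] factors as [(g \o s) \o f] for a section [s] of [f]. Comparing fibres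
    on the support alone is what lets a single observer suffice later. *)
Lemma freeg_map_factor_eq0 (S T U : choiceType) (f : S -> T) (g : S -> U)
    (u : {freeg S / int}) :
  {in dom u &, forall a b, f a = f b -> g a = g b} ->
  freeg_map f u = 0 -> freeg_map g u = 0.
Proof.
move=> fg fu0; have [->|u0] := eqVneq u 0; first by rewrite raddf0.
have [s sP] : exists s : T -> S,
    {in dom u, forall a, s (f a) \in dom u /\ f (s (f a)) = f a}.
  by apply: section_on_seq; rewrite dom_eq0.
have gs : {in dom u, g =1 (g \o s) \o f}.
  by move=> a ua /=; have [sa fsa] := sP a ua; apply: fg.
by rewrite (eq_in_freeg_map gs) freeg_map_comp fu0 raddf0.
Qed.

Lemma ker_freeg_map (S T : choiceType) (f : S -> T) :
  ker (freeg_map f) =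
  generated_subgroup [set u : {freeg S / int} |
    exists a b : S, f a = f b /\ u = << a >> - << b >>].
Proof.
apply/seteqP; split=> [u fu0 H [Hz sH]|]; last first.
  apply: smallest_sub; last first.
    by move=> _ [a [b [fab ->]]]; rewrite /ker /= raddfB /= !freeg_mapU fab subrr.
  split=> [|u v /set_mem fu /set_mem fv]; apply/mem_set; rewrite /ker /=.
    by rewrite raddf0.
  by rewrite raddfB fu fv subrr.
pose K : zmodClosed {freeg S / int} := HB.pack
  ([in H] : {pred {freeg S / int}}) (GRing.isZmodClosed.Build _ _ Hz).
have [->|u0] := eqVneq u 0; first by apply: set_mem; apply: (rpred0 K).
have [s sP] : exists s : T -> S,
    {in dom u, forall a, s (f a) \in dom u /\ f (s (f a)) = f a}.
  by apply: section_on_seq; rewrite dom_eq0.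
have su0 : freeg_map (s \o f) u = 0 by rewrite freeg_map_comp fu0 raddf0.
(* Subtracting the zero element [freeg_map (s \o f) u] writes [u] as a combination of the
   differences [<< a >> - << s (f a) >>]. *)
rewrite -[u]subr0 -su0 freeg_map_sum {1}[u]freeg_sum_mulrz -sumrB.
apply: set_mem; rewrite big_seq; apply: (@rpred_sum _ K) => a ua /=.
rewrite -mulrzBl; apply: (@rpredMz _ K); apply/mem_set/sH.
by exists a, (s (f a)); split=> //; have [_ ->] := sP a ua.
Qed.

(** First isomorphism theorem, with surjectivity given by a right inverse [g], which need not be
    additive. *)
Lemma quot_ker_bij (U V : zmodType) (I : zmodClosed U) (h : {additive U -> V})
    (g : V -> U) :
  cancel g h -> (forall u, u \in I = (h u == 0)) ->
  exists F : {additive Quotient.quot I -> V}, bijective F.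
Proof.
move=> gK Ih; pose F (q : Quotient.quot I) := h (repr q).
have FE u : F (\pi u) = h u.
  by apply/eqP; rewrite -subr_eq0 -raddfB -Ih Quotient.idealrBE reprK.
have Fadd : zmod_morphism F.
  move=> p q; rewrite -[p]reprK -[q]reprK -raddfB !FE.
  exact: raddfB.
pose Fm : {additive Quotient.quot I -> V} :=
  HB.pack F (GRing.isZmodMorphism.Build _ _ F Fadd).
exists Fm; have Fg : cancel (fun v => \pi_(Quotient.quot I) (g v)) Fm by move=> v; rewrite /= FE.
exists (fun v => \pi_(Quotient.quot I) (g v)) => //; apply: inj_can_sym Fg _ => p q pq.
rewrite -[p]reprK -[q]reprK; apply/eqP; rewrite -Quotient.idealrBE Ih raddfB.
by rewrite subr_eq0; apply/eqP.
Qed.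

(** Corestricting [f] to its range makes it surjective without changing its fibres, hence without
    changing the kernel of the induced map. *)
Lemma quot_ker_freeg_map (S T : choiceType) (f : S -> T)
    (I : zmodClosed {freeg S / int}) :
  (forall u, u \in I <-> freeg_map f u = 0) ->
  exists F : {additive Quotient.quot I -> {freeg (set_type (range f)) / int}},
    bijective F.
Proof.
move=> If.
pose f' (a : S) : set_type (range f) :=
  exist _ (f a) (mem_set (imageT f a)).
have f'_surj y : exists a, f' a = y.
  by case: y => y ry; have [a _ fa] := set_mem ry; exists a; apply: val_inj.
have [s sK] := choice f'_surj.
apply: (@quot_ker_bij _ _ I (freeg_map f') (freeg_map s)) => u.
  rewrite /= -freeg_map_comp -[RHS]freeg_map_id; apply: eq_in_freeg_map => y _.
  exact: sK.
apply/idP/eqP => [/If|f'u0]; [|apply/If; move: f'u0];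
  apply: freeg_map_factor_eq0 => a b _ _.
  by move=> fab; apply: val_inj.
by move/(congr1 val).
Qed.

(** * Finite-index subgroups obtained from homomorphisms to a finite group *)

Local Open Scope group_scope.

Lemma ghom_eq_on_generators (G H : groupType) (s : seq G)
    (h k : {ghom G -> H}) :
  smallest [set A : set G | group_closed [in A]] [set` s] = [set: G] ->
  {in s, h =1 k} -> h =1 k.
Proof.
move=> sG hk x; have : [set: G] x by [].
rewrite -sG; apply: (smallest_sub (X := [set y | h y = k y])) => //.
split=> [|y z /set_mem hy /set_mem hz]; apply/mem_set => /=.
  by rewrite !gmulf1.
by rewrite !gmulfF hy hz.
Qed.

Lemma finite_set_inj_fintype (T : choiceType) :
  finite_set [set: T] -> exists (F : finType) (m : T -> F), injective m.
Proof.
case/finite_seqP => s Ts; have sT x : x \in s.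
  by have : [set: T] x by []; rewrite Ts.
exists (seq_sub s), (fun x => SeqSub (sT x)).
by move=> x y [].
Qed.

Section HomKernel.
Variables (G Q : groupType).

Definition hom_kernel : normal_subgroup G.
Proof.
apply: (@NormalSubgroup G [set x | forall h : {ghom G -> Q}, h x = 1]).
- split=> [|x y /set_mem Kx /set_mem Ky]; apply/mem_set => h.
    by rewrite gmulf1.
  by rewrite gmulfF Kx Ky divg1.
- by move=> x g Kx h; rewrite gmulfJ Kx conj1g.
Defined.

(** Precomposing a homomorphism to [Q] with [phi] gives another one. *)
Lemma hom_kernel_stable (phi : {ghom G -> G}) x :
  nsub_set hom_kernel x -> nsub_set hom_kernel (phi x).
Proof. by move=> Kx h; apply: (Kx (h \o phi)). Qed.

(* A homomorphism is determined by its values on a finite generating tuple, so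
   there are finitely many homomorphisms into a finite group. *)
Lemma hom_kernel_finite_index :
  finitely_generated G -> finite_set [set: Q] -> finite_index hom_kernel.
Proof.
case=> s sG /finite_set_inj_fintype[F [m m_inj]].
pose v (h : {ghom G -> Q}) : (size s).-tuple F := map_tuple (m \o h) (in_tuple s).
have v_inj h k : v h = v k -> h =1 k.
  move/(congr1 val) => /= /eq_in_map hk.
  by apply: (ghom_eq_on_generators sG) => x /hk; apply: m_inj.
(* [e x] tabulates the images of [x] under all homomorphisms, indexed by their values on the
   generators; [None] marks tuples that no homomorphism realizes. *)
pose e (x : G) : {ffun (size s).-tuple F -> option F} :=
  [ffun t => if pselect (exists h, v h = t) is left ex
             then Some (m (projT1 (cid ex) x)) else None].
have e_inj x y : e x = e y -> quotg_pi hom_kernel x = quotg_pi hom_kernel y.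
  move=> exy; apply/quotg_eqP => h; rewrite gmulfM gmulfV.
  move/ffunP/(_ (v h)) : exy; rewrite !ffunE.
  case: pselect => [ex|[]]; last by exists h.
  case: (cid ex) => k /= /v_inj kh [/m_inj].
  by rewrite !kh => ->; rewrite mulVg.
rewrite /finite_index -(preimage_setT (fun c : quotg hom_kernel => e (repr c))).
apply: finite_preimage; last exact: finite_finset.
move=> c d _ _ /e_inj; rewrite /quotg_pi.
by move=> cd; rewrite -[c]reprK -[d]reprK.
Qed.

End HomKernel.

(** * Finite observers and the classes they separate *)

Section Observers.
Variables (G : groupType) (phi : {ghom G -> G}).

Definition obs_fin (N : observer phi) : fin_nsub G := FinNsub (obs_finite N).

(** The quotient map to [quotg N] is among the homomorphisms defining [hom_kernel G (quotg N)], so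
    that observer lies inside its kernel [N]. *)
Lemma observer_cofinal (N : fin_nsub G) : finitely_generated G ->
  exists K : observer phi, nsub_set K `<=` nsub_set N.
Proof.
move=> fgG.
exists (Observer (hom_kernel_finite_index fgG (fin_nsubP N))
  (@hom_kernel_stable G (quotg N) phi)) => x Kx.
have /quotg_eqP : quotg_pi N 1 = quotg_pi N x by rewrite gmulf1 (Kx (quotg_pi N)).
by rewrite invg1 mul1g.
Qed.

Definition observerT : observer phi :=
  @Observer G phi (nsubT G) (nsubT_finite G) (fun _ _ => I).

Lemma observerI (M N : observer phi) : exists K : observer phi,
  nsub_set K `<=` nsub_set M /\ nsub_set K `<=` nsub_set N.
Proof.
have stable x : nsub_set (nsubI M N) x -> nsub_set (nsubI M N) (phi x).
  by case=> Mx Nx; split; apply: obs_stable.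
exists (Observer (@nsubI_finite G (obs_fin M) (obs_fin N)) stable).
by split=> x [].
Qed.

Lemma quotg_pi_sub (M N : normal_subgroup G) x y :
  nsub_set M `<=` nsub_set N ->
  quotg_pi M x = quotg_pi M y -> quotg_pi N x = quotg_pi N y.
Proof. by move=> MN /quotg_eqP/MN/quotg_eqP. Qed.

Lemma quotg_pi_twisted (N : observer phi) g a :
  quotg_pi N (g * a * (phi g)^-1) =
  quotg_pi N g * quotg_pi N a * (obs_endo N (quotg_pi N g))^-1.
Proof. by rewrite -obs_endoE 2!gmulfM gmulfV. Qed.

(** Lifting conjugators to [G] makes the conditions for different observers comparable. *)
Lemma obs_reidemeister_eqP (N : observer phi) a b :
  obs_reidemeister N (rclass phi a) = obs_reidemeister N (rclass phi b) <->
  exists g, quotg_pi N b = quotg_pi N (g * a * (phi g)^-1).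
Proof.
rewrite /obs_reidemeister !reidemeister_mapE; split.
  case/rclass_eqP=> c; have [g ->] := quotg_surj c => bE; exists g.
  by rewrite quotg_pi_twisted -bE.
case=> g bE; apply/rclass_eqP; exists (quotg_pi N g).
by rewrite -quotg_pi_twisted -bE.
Qed.

Lemma obs_reidemeister_sub (M N : observer phi) alpha beta :
  nsub_set M `<=` nsub_set N ->
  obs_reidemeister M alpha = obs_reidemeister M beta ->
  obs_reidemeister N alpha = obs_reidemeister N beta.
Proof.
move=> MN; rewrite -[alpha]reprK -[beta]reprK.
move=> /obs_reidemeister_eqP[g bE]; apply/obs_reidemeister_eqP; exists g.
exact: quotg_pi_sub bE.
Qed.

Lemma observer_separating (r : seq (reidemeister phi * reidemeister phi)) :
  exists N : observer phi, {in r, forall p,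
    obs_reidemeister N p.1 = obs_reidemeister N p.2 ->
    forall K : observer phi, obs_reidemeister K p.1 = obs_reidemeister K p.2}.
Proof.
elim: r => [|p r [N Nr]]; first by exists observerT.
have [M Mp] : exists M : observer phi,
    obs_reidemeister M p.1 = obs_reidemeister M p.2 ->
    forall K : observer phi, obs_reidemeister K p.1 = obs_reidemeister K p.2.
  (* If no observer separates [p], any [M] works; otherwise a separating [M] makes the premise
     false. *)
  have [pK|/existsNP[M Mp]] := pselect (forall K : observer phi,
    obs_reidemeister K p.1 = obs_reidemeister K p.2); first by exists observerT.
  by exists M => /Mp.
have [K [KM KN]] := observerI M N; exists K => q.
rewrite in_cons => /orP[/eqP->|rq] Kq.
  exact/Mp/(obs_reidemeister_sub KM).
exact/(Nr q rq)/(obs_reidemeister_sub KN).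
Qed.

End Observers.

(** * Compactness of the profinite completion through ultrafilters *)

Lemma ultrafilter_finite (T : Type) (F : finType) (U : set_system T)
    (m : T -> F) : UltraFilter U -> exists i, U [set t | m t = i].
Proof.
move=> UU; apply: contrapT => /forallNP nU.
(* Finitely many complements of fibres meet in a set of [U], yet no [t] avoids the fibre of
   [m t]. *)
have : \forall t \near U, forall i, m t <> i.
  apply: filter_forall => i.
  by have [/nU//|] := in_ultra_setVsetC [set t | m t = i] UU.
by move/filter_ex => [t /(_ (m t))].
Qed.

Section Compactness.
Variables (G : groupType).

Lemma ultrafilter_profinite (U : set_system G) : UltraFilter U ->
  exists x : profinite G, forall N : fin_nsub G,
    U [set g | quotg_pi N g = profinite_proj N x].
Proof.
move=> UU.
have lim N : exists c : quotg (fin_nsub_val N), U [set g | quotg_pi N g = c].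
  have [F [m m_inj]] := finite_set_inj_fintype (fin_nsubP N).
  have [i Ui] := ultrafilter_finite (m \o quotg_pi N) UU.
  have [g gi] := filter_ex Ui; exists (quotg_pi N g).
  by apply: filterS Ui => h /= hi; apply: m_inj; rewrite hi.
pose x N := projT1 (cid (lim N)).
have Ux (N : fin_nsub G) : U [set g | quotg_pi N g = x N] := projT2 (cid (lim N)).
have x_coh (M N : fin_nsub G) (MN : nsub_set M `<=` nsub_set N) :
    quotg_transition MN (x M) = x N.
  (* Two sets of [U] meet, so one [g] represents both cosets. *)
  have [g [/= <- <-]] := filter_ex (filterI (Ux M) (Ux N)).
  exact: quotg_transitionE.
by exists (profinite_of x_coh).
Qed.

Variables (phi : {ghom G -> G}) (phihat : {ghom profinite G -> profinite G}).
Hypothesis phihat_ext : continuous_extension phi phihat.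

(** By uniqueness [phihat] is [profinite_map phi], whose component at [N] is read off at the
    preimage of [N]; stability puts [N] inside that preimage. *)
Lemma profinite_proj_extension (N : observer phi) x :
  profinite_proj (obs_fin N) (phihat x) =
  obs_endo N (profinite_proj (obs_fin N) x).
Proof.
rewrite (continuous_extension_unique phihat_ext (profinite_mapP phi)).
have NN : nsub_set (obs_fin N) `<=` nsub_set (preim_fin phi (obs_fin N)).
  exact: obs_stable.
rewrite -[LHS]/(preim_map phi (obs_fin N)
  (profinite_proj (preim_fin phi (obs_fin N)) x)).
rewrite -(profinite_coherent x NN).
have [g ->] := quotg_surj (profinite_proj (obs_fin N) x).
by rewrite quotg_transitionE preim_mapE -obs_endoE.
Qed.

Lemma profinite_ext_observers (x y : profinite G) : finitely_generated G ->
  (forall N : observer phi,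
     profinite_proj (obs_fin N) x = profinite_proj (obs_fin N) y) -> x = y.
Proof.
move=> fgG xy; apply: profinite_ext => N.
have [K KN] := observer_cofinal phi N fgG.
have KN' : nsub_set (obs_fin K) `<=` nsub_set N by [].
by rewrite -!(profinite_coherent _ KN') xy.
Qed.

Let j : reidemeister phi -> reidemeister phihat :=
  reidemeister_map (@to_profinite G) (proj2 phihat_ext).

(* The solutions g of b = g a (phi g)^-1 modulo the observers form a filter
   base on G; an ultrafilter containing it converges in the profinite completion
   to a conjugator there. *)
Lemma completion_reidemeister_eqP alpha beta : finitely_generated G ->
  j alpha = j beta <->
  forall N : observer phi, obs_reidemeister N alpha = obs_reidemeister N beta.
Proof.
move=> fgG; rewrite -[alpha]reprK -[beta]reprK.
move: (repr alpha) (repr beta) => a b {alpha beta}.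
rewrite /j -/(rclass phi a) -/(rclass phi b) !reidemeister_mapE; split.
  case/rclass_eqP => x bE N; apply/obs_reidemeister_eqP.
  have [g xg] := quotg_surj (profinite_proj (obs_fin N) x); exists g.
  have := congr1 (profinite_proj (obs_fin N)) bE.
  rewrite -[LHS]/(quotg_pi N b) => ->.
  rewrite -[LHS]/(profinite_proj (obs_fin N) x * quotg_pi N a *
    (profinite_proj (obs_fin N) (phihat x))^-1).
  by rewrite profinite_proj_extension xg quotg_pi_twisted.
move=> ab.
pose A (N : observer phi) :=
  [set g | quotg_pi N b = quotg_pi N (g * a * (phi g)^-1)].
have FA : ProperFilter (filter_from [set: observer phi] A).
  apply: filter_from_proper; last first.
    by move=> N _; apply/obs_reidemeister_eqP.
  apply: filter_from_filter => [|M N _ _]; first by exists (observerT phi).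
  have [K [KM KN]] := observerI M N; exists K => // g Ag.
  by split; apply: quotg_pi_sub Ag.
have [U [UU AU]] := ultraFilterLemma FA.
have [x Ux] := ultrafilter_profinite UU.
apply/rclass_eqP; exists x; apply: profinite_ext_observers => // N.
rewrite -[LHS]/(quotg_pi N b).
rewrite -[RHS]/(profinite_proj (obs_fin N) x * quotg_pi N a *
  (profinite_proj (obs_fin N) (phihat x))^-1).
have AN : U (A N) by apply: AU; exists N.
have [g [/= -> gx]] := filter_ex (filterI AN (Ux (obs_fin N))).
by rewrite profinite_proj_extension -gx quotg_pi_twisted.
Qed.

End Compactness.

Local Open Scope ring_scope.

Theorem corollary4p4 (G : groupType) (phi : {ghom G -> G})
    (fgG : finitely_generated G)
    (phihat : {ghom profinite G -> profinite G})
    (phihat_ext : continuous_extension phi phihat) :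
  let j : reidemeister phi -> reidemeister phihat :=
    reidemeister_map (@to_profinite G) (proj2 phihat_ext) in
  [/\ blind phi = ker (freeg_map j),
      ker (freeg_map j) =
        generated_subgroup
          [set u : {freeg (reidemeister phi) / int} |
            exists alpha beta : reidemeister phi,
              j alpha = j beta /\ u = << alpha >> - << beta >>]
    & exists f : {additive Quotient.quot (blind_pred phi) ->
          {freeg (set_type (range j)) / int}},
        bijective f].
Proof.
move=> j.
have jP alpha beta := completion_reidemeister_eqP phihat_ext alpha beta fgG.
have blindE : blind phi = ker (freeg_map j).
  apply/seteqP; split=> u.
    move=> Bu; have [N NP] := observer_separating
      [seq (alpha, beta) | alpha <- dom u, beta <- dom u].
    apply: freeg_map_factor_eq0 (Bu N I) => alpha beta ua ub ab.
    by apply/jP; apply: (NP (alpha, beta)); first exact: allpairs_f.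
  (* Conversely, every observer identifies classes with equal image under [j]. *)
  move=> ju0 N _; apply: freeg_map_factor_eq0 ju0 => alpha beta _ _.
  by move/jP; apply.
split=> //; first exact: ker_freeg_map.
apply: (@quot_ker_freeg_map _ _ j (blind_pred phi)) => u.
have -> : freeg_map j u = 0 <-> blind phi u by rewrite blindE.
by split=> [/set_mem|Bu] //; apply: (mem_set Bu).
Qed.
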